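(* Let $R$ be an integral domain with integral closure $R'$ in $\mathrm{qf}(R)$, and suppose that $R$ is a maximal non pseudo-valuation subring of $R'$. Then the following are equivalent: (i) $R$ is a maximal non valuative subring of $R'$. (ii) $R$ is not valuative, $R'$ is a valuation domain, and $R$ has a unique minimal overring $S$ in $R'$ that is valuative (i.e. the unique minimal overring of $R$ in $R'$ exists and is a valuative domain).
   Context: All rings are commutative with identity and are integral domains; $\mathrm{qf}(R)$ denotes the quotient field of $R$. The symbol $\subset$ denotes proper inclusion. An integral domain $R$ is a valuative domain if for each nonzero $x\in \mathrm{qf}(R)$, at least one of the extensions $R\subseteq R[x]$ and $R\subseteq R[x^{-1}]$ has no ring strictly between its two ends (equality of the two ends is allowed). A proper subring $R$ of an integral domain $T$ is a maximal non valuative subring of $T$ if $R$ is not a valuative domain but every subring of $T$ properly containing $R$ is a valuative domain. A domain $R$ is a pseudo-valuation domain if for every prime ideal $P$ of $R$ and all $x,y\in\mathrm{qf}(R)$ with $xy\in P$, either $x\in P$ or $y\in P$. A proper subring $R$ of a domain $T$ is a maximal non pseudo-valuation subring of $T$ if $R$ is not a pseudo-valuation domain but each subring of $T$ properly containing $R$ is a pseudo-valuation domain. For a proper ring extension $R\subset B$, a ring $S$ with $R\subset S\subseteq B$ is called the unique minimal overring of $R$ in $B$ if every ring $A$ with $R\subset A\subseteq B$ contains $S$. *)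

(* Defs.v *)
From HB Require Import structures.
From mathcomp Require Import all_boot all_order all_algebra.
From mathcomp Require Import boolp classical_sets.

Set Implicit Arguments.
Unset Strict Implicit.
Unset Printing Implicit Defensive.

Import GRing.Theory.
Local Open Scope classical_set_scope.
Local Open Scope ring_scope.

(* Integral domains are handled as subrings of an ambient field K.  The
   properties below are meant for sets that are subrings, but the predicates
   on a single ring do not repeat that requirement. *)

Definition is_subring (K : fieldType) (S : set K) : Prop :=
  GRing.subring_closed (mem S).

(* The quotient field of S, inside K. *)
Definition qf (K : fieldType) (S : set K) : set K :=
  [set x | exists a b, [/\ S a, S b, b != 0 & x = a / b]].

(* The ring S[x]. *)
Definition adjoin (K : fieldType) (S : set K) (x : K) : set K :=
  [set y | exists2 p : {poly K}, p \is a polyOver (mem S) & y = p.[x]].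

Definition no_ring_strictly_between (K : fieldType) (A B : set K) : Prop :=
  ~ exists C : set K, [/\ is_subring C, A `<` C & C `<` B].

Definition valuative (K : fieldType) (S : set K) : Prop :=
  forall x, qf S x -> x != 0 ->
    no_ring_strictly_between S (adjoin S x) \/
    no_ring_strictly_between S (adjoin S x^-1).

Definition valuation_domain (K : fieldType) (S : set K) : Prop :=
  forall x, qf S x -> x != 0 -> S x \/ S x^-1.

Definition is_ideal (K : fieldType) (S P : set K) : Prop :=
  [/\ P `<=` S, P 0,
      forall x y, P x -> P y -> P (x + y)
    & forall a x, S a -> P x -> P (a * x)].

Definition prime_ideal (K : fieldType) (S P : set K) : Prop :=
  [/\ is_ideal S P, ~ P 1
    & forall x y, S x -> S y -> P (x * y) -> P x \/ P y].

Definition pseudo_valuation (K : fieldType) (S : set K) : Prop :=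
  forall P, prime_ideal S P ->
    forall x y, qf S x -> qf S y -> P (x * y) -> P x \/ P y.

(* R is a maximal non-Q subring of the domain T, for a property Q of domains. *)
Definition maximal_non (K : fieldType) (Q : set K -> Prop) (R T : set K)
    : Prop :=
  [/\ is_subring R, R `<` T, ~ Q R
    & forall S, is_subring S -> R `<` S -> S `<=` T -> Q S].

Definition unique_minimal_overring (K : fieldType) (R B S : set K) : Prop :=
  [/\ is_subring S, R `<` S, S `<=` B
    & forall A, is_subring A -> R `<` A -> A `<=` B -> S `<=` A].

(* The copy of R inside its quotient field {fraction R}. *)
Definition base_ring (R : idomainType) : set {fraction R} :=
  range (@tofrac R).

Definition integral_closure (R : idomainType) : set {fraction R} :=
  [set x | integralOver (@tofrac R) x].

(* Main.v *)
Require Import Defs.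
From HB Require Import structures.
From mathcomp Require Import all_boot all_order all_algebra all_solvable all_field.
From mathcomp Require Import boolp classical_sets.

Set Implicit Arguments.
Unset Strict Implicit.
Unset Printing Implicit Defensive.

Import GRing.Theory UnityRootTheory.
Local Open Scope classical_set_scope.
Local Open Scope ring_scope.

(* Write V = R' and let N be the set of nonunits of V, once V is known to be a
   valuation ring.  A ring T between R and V is a pseudo-valuation domain
   exactly when it contains N.  So every ring properly between R and V contains
   N while R does not, and R + N is the unique minimal overring of R in V.
   From (i), V is integrally closed, pseudo-valuation and valuative, and these
   three properties make it a valuation ring.
   From (ii), all rings between S and V contain N, so everything takes place in
   the residue field L = V/N, algebraic over k = S/N: "valuative" says that
   k(u) is a minimal extension of k for each u in L.  This passes from k to any
   intermediate field D: by the primitive element theorem, L is either a simple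
   minimal extension of k, or purely inseparable of exponent one over k. *)

(** * Subrings and adjunction *)

Section Subrings.
Variables (K : fieldType) (S : set K).

Lemma subringI : S 1 -> (forall x y, S x -> S y -> S (x - y)) ->
  (forall x y, S x -> S y -> S (x * y)) -> is_subring S.
Proof.
move=> S1 SB SM; split=> [|x y|x y]; first exact/mem_set.
- by move=> /set_mem Sx /set_mem Sy; apply/mem_set/SB.
- by move=> /set_mem Sx /set_mem Sy; apply/mem_set/SM.
Qed.

Hypothesis hS : is_subring S.

Lemma subring1 : S 1. Proof. by case: hS => /set_mem. Qed.

Lemma subringB x y : S x -> S y -> S (x - y).
Proof. by case: hS => _ h _ /mem_set Sx /mem_set Sy; apply/set_mem/h. Qed.

Lemma subringM x y : S x -> S y -> S (x * y).
Proof. by case: hS => _ _ h /mem_set Sx /mem_set Sy; apply/set_mem/h. Qed.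

Lemma subring0 : S 0.
Proof. by rewrite -(subrr 1); apply: subringB; apply: subring1. Qed.

Lemma subringN x : S x -> S (- x).
Proof. by move=> Sx; rewrite -sub0r; apply: subringB => //; apply: subring0. Qed.

Lemma subringD x y : S x -> S y -> S (x + y).
Proof. by move=> Sx Sy; rewrite -[y]opprK; apply/subringB/subringN. Qed.

Lemma subringX x n : S x -> S (x ^+ n).
Proof.
move=> Sx; elim: n => [|n IHn]; first exact: subring1.
by rewrite exprS; apply: subringM.
Qed.

Lemma subring_nat n : S n%:R.
Proof.
elim: n => [|n IHn]; first exact: subring0.
by rewrite mulrS; apply: subringD => //; apply: subring1.
Qed.

Lemma subring_sum I (r : seq I) (F : I -> K) :
  (forall i, S (F i)) -> S (\sum_(i <- r) F i).
Proof.
by move=> SF; apply: big_ind => //; [apply: subring0 | apply: subringD].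
Qed.

Lemma subring_horner (p : {poly K}) x : (forall i, S p`_i) -> S x -> S p.[x].
Proof.
move=> Sp Sx; rewrite horner_coef; apply: subring_sum => i.
by apply: subringM => //; apply: subringX.
Qed.

End Subrings.

Section Adjoin.
Variables (K : fieldType) (S : set K).
Hypothesis hS : is_subring S.

Lemma adjoinP x y :
  adjoin S x y <-> exists2 p : {poly K}, (forall i, S p`_i) & y = p.[x].
Proof.
split=> [[p /(all_nthP 0) Sp ->]|[p Sp ->]]; exists p => //.
  move=> i; have [ltip|leip] := ltnP i (size p); first exact/set_mem/Sp.
  by rewrite nth_default //; apply: subring0.
by apply/(all_nthP 0) => i _; apply/mem_set/Sp.
Qed.

Lemma adjoin_min (C : set K) x :
  is_subring C -> S `<=` C -> C x -> adjoin S x `<=` C.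
Proof.
move=> hC SC Cx y /adjoinP[p Sp ->].
by apply: subring_horner => // i; apply: SC.
Qed.

Lemma adjoin_subring x : is_subring (adjoin S x).
Proof.
apply: subringI.
- apply/adjoinP; exists 1; rewrite ?hornerC // => i.
  by rewrite coef1; case: eqP => _; [apply: subring1 | apply: subring0].
- move=> _ _ /adjoinP[p Sp ->] /adjoinP[q Sq ->]; apply/adjoinP.
  exists (p - q); rewrite ?hornerE // => i.
  by rewrite coefB; apply: subringB.
- move=> _ _ /adjoinP[p Sp ->] /adjoinP[q Sq ->]; apply/adjoinP.
  exists (p * q); rewrite ?hornerE // => i.
  by rewrite coefM; apply: subring_sum => // j; apply: subringM.
Qed.

Lemma adjoin_base x : S `<=` adjoin S x.
Proof.
move=> y Sy; apply/adjoinP; exists y%:P; rewrite ?hornerC // => i.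
by rewrite coefC; case: eqP => _ //; apply: subring0.
Qed.

Lemma adjoin_gen x : adjoin S x x.
Proof.
apply/adjoinP; exists 'X; rewrite ?hornerX // => i.
by rewrite coefX; case: eqP => _; [apply: subring1 | apply: subring0].
Qed.

Lemma adjoin_sub x y : adjoin S x y -> adjoin S y `<=` adjoin S x.
Proof.
by move=> Sxy; apply: adjoin_min => //; [apply: adjoin_subring | apply: adjoin_base].
Qed.

(** A ring strictly between contains [adjoin S e] for each of its elements [e], so only rings
    generated by one element need testing. *)
Lemma no_ring_betweenP x :
  no_ring_strictly_between S (adjoin S x) <->
  forall e, adjoin S x e -> S e \/ adjoin S e x.
Proof.
split=> [noC e Sxe|hx [C [hC [SC nCS] [Cx nxC]]]].
- apply: contrapT => /not_orP[nSe nSex]; apply: noC; exists (adjoin S e).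
  split; first exact: adjoin_subring.
  + split; first exact: adjoin_base.
    by move=> h; apply/nSe/h/adjoin_gen.
  + split; first exact: adjoin_sub.
    by move=> h; apply/nSex/h/adjoin_gen.
- apply: nCS => e Ce; have [//|Sex] := hx _ (Cx _ Ce).
  case: nxC; apply: adjoin_min => //.
  by have /(_ x Sex) := adjoin_min hC SC Ce.
Qed.

End Adjoin.

(** * Primitive elements *)

Definition is_subfield (L : fieldType) (k : set L) : Prop :=
  is_subring k /\ forall x, k x -> k x^-1.

Section SubfieldType.
Variables (L : fieldType) (k : set L) (hk : is_subfield k).

(** The proof of [is_subfield k] is an argument so that the closure instance can be attached to the
    predicate. *)
Definition subfield_pred of is_subfield k : {pred L} := fun x => `[< k x >].

Lemma subfield_predP x : reflect (k x) (x \in subfield_pred hk).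
Proof. exact: asboolP. Qed.

Fact subfield_pred_divring : divring_closed (subfield_pred hk).
Proof.
have [hr hV] := hk; split=> [|x y|x y].
- by apply/subfield_predP; apply: subring1.
- by move=> /subfield_predP kx /subfield_predP ky; apply/subfield_predP; apply: subringB.
- move=> /subfield_predP kx /subfield_predP ky; apply/subfield_predP.
  by apply: subringM (hV _ _).
Qed.

HB.instance Definition _ :=
  GRing.isDivringClosed.Build L (subfield_pred hk) subfield_pred_divring.

Definition subfield_type := {x | subfield_pred hk x}.

HB.instance Definition _ := [isSub of subfield_type for @sval L _].
HB.instance Definition _ := [Choice of subfield_type by <:].
HB.instance Definition _ := [SubChoice_isSubIntegralDomain of subfield_type by <:].
HB.instance Definition _ := [SubIntegralDomain_isSubField of subfield_type by <:].

End SubfieldType.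

(** Replaces a subfield given as a set by a field type with an embedding, the setting of the
    primitive element results. *)
Lemma subfield_rangeP (L : fieldType) (k : set L) : is_subfield k ->
  exists (F : fieldType) (iota : {rmorphism F -> L}),
    forall x, k x <-> exists y, x = iota y.
Proof.
move=> hk; exists (subfield_type hk), (val : {rmorphism subfield_type hk -> L}) => x.
split=> [kx|[[y ky] ->]]; last exact/asboolP.
have kx' : subfield_pred hk x by apply/asboolP.
by exists (Sub x kx').
Qed.

(** Multiplication by [x] permutes [G]; comparing products over [G] gives [x ^+ n = 1] with
    [n = size G]. So [G] consists of [n] distinct roots of unity, one of which is primitive. *)
Lemma finite_mul_closed_cyclic (L : fieldType) (G : seq L) :
    uniq G -> 1 \in G -> 0 \notin G ->
    (forall x y, x \in G -> y \in G -> x * y \in G) ->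
  exists z, forall x, x \in G -> exists i, x = z ^+ i.
Proof.
move=> uG G1 G0 GM; set n := size G.
have n_gt0 : (0 < n)%N by rewrite /n; case: (G) G1.
have nz x : x \in G -> x != 0 by apply: contraTneq => ->.
have Gn x : x \in G -> x ^+ n = 1.
  move=> Gx; have inj_x : injective ( *%R x) by apply: mulfI; apply: nz.
  have uxG : uniq [seq x * y | y <- G] by rewrite map_inj_uniq.
  have sxG : {subset [seq x * y | y <- G] <= G}.
    by move=> _ /mapP[y Gy ->]; apply: GM.
  have [|_ eqG] := uniq_min_size uxG sxG; first by rewrite size_map.
  have prodE : \prod_(y <- [seq x * y | y <- G]) y = \prod_(y <- G) y.
    by apply: perm_big; apply: uniq_perm.
  move: prodE; rewrite big_map big_split /= big_const_seq count_predT.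
  rewrite iter_mulr_1 => /(congr1 (fun y => y / \prod_(i <- G) i)).
  have nzG : \prod_(i <- G) i != 0.
    by rewrite prodf_seq_neq0; apply/allP => y /nz ->.
  by rewrite mulfK // divff.
have /hasP[z _ prim_z] : has n.-primitive_root G.
  apply: has_prim_root => //; apply/allP => x /Gn xn.
  by rewrite unity_rootE xn.
by exists z => x /Gn /(prim_rootP prim_z)[i ->]; exists i.
Qed.

(** The products [u ^+ i * v ^+ j] form a finite multiplicatively closed set, hence a cyclic
    group. *)
Lemma torsion_common_power (L : fieldType) (u v : L) (a b : nat) :
    u ^+ a.+1 = 1 -> v ^+ b.+1 = 1 ->
  exists z i j, u = z ^+ i /\ v = z ^+ j.
Proof.
move=> ua vb.
have nzpow (w : L) n : w ^+ n.+1 = 1 -> w != 0.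
  move=> wn; apply: contra_eq_neq wn => ->; rewrite expr0n /= eq_sym.
  exact: oner_neq0.
pose G := undup [seq u ^+ i * v ^+ j | i <- iota 0 a.+1, j <- iota 0 b.+1].
have GP i j : u ^+ i * v ^+ j \in G.
  rewrite mem_undup -(expr_mod i ua) -(expr_mod j vb).
  apply/allpairsP; exists (i %% a.+1, j %% b.+1)%N.
  by split; rewrite // mem_iota ltn_mod.
have PG x : x \in G -> exists i j, x = u ^+ i * v ^+ j.
  by rewrite mem_undup => /allpairsP[[i j] [_ _ ->]]; exists i, j.
have [||||z zP] := @finite_mul_closed_cyclic L G.
- exact: undup_uniq.
- by have := GP 0 0; rewrite !expr0 mulr1.
- apply/negP => /PG[i [j /esym/eqP]].
  by rewrite mulf_eq0 !expf_eq0 (negPf (nzpow _ _ ua)) (negPf (nzpow _ _ vb)) !andbF.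
- move=> _ _ /PG[i [j ->]] /PG[i' [j' ->]].
  by rewrite mulrACA -!exprD GP.
have Gu : u \in G by have := GP 1 0; rewrite expr0 expr1 mulr1.
have Gv : v \in G by have := GP 0 1; rewrite expr0 expr1 mul1r.
by have [i ->] := zP u Gu; have [j ->] := zP v Gv; exists z, i, j.
Qed.

Section PrimitiveElement.
Variables (F L : fieldType) (iota : {rmorphism F -> L}).
Local Notation "p ^ f" := (map_poly f p) : ring_scope.

Lemma algebraic_over_finite_torsion (s : seq F) (p : {poly F}) (u : L) :
    (forall x, x \in s) -> p != 0 -> root (p ^ iota) u -> u != 0 ->
  exists a, u ^+ a.+1 = 1.
Proof.
move=> sP nz_p pu0 nz_u; set d := size p; set n := size s.
(* [h i] records the coefficients of ['X^i %% p] by their indices in [s], and [h'] decodes it to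
   [u ^+ i]. There is one more exponent than codes, so two powers of [u] agree. *)
pose h (i : 'I_(n ^ d).+1) : {ffun 'I_d -> 'I_n} :=
  [ffun j : 'I_d => Ordinal (etrans (index_mem _ _) (sP ('X^i %% p)`_j))].
pose h' (f : {ffun 'I_d -> 'I_n}) := \sum_(j < d) iota s`_(f j) * u ^+ j.
have hK i : h' (h i) = u ^+ i.
  have -> : u ^+ i = (('X^i %% p) ^ iota).[u].
    have : ('X^i ^ iota).[u] = u ^+ i by rewrite map_polyXn hornerXn.
    rewrite {1}(divp_eq 'X^i p) rmorphD rmorphM hornerD hornerM (rootP pu0) mulr0.
    by rewrite add0r.
  rewrite (@horner_coef_wide _ d) ?size_map_poly; last by rewrite ltnW // ltn_modp.
  by apply: eq_bigr => j _; rewrite coef_map ffunE /= nth_index.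
have [inj_h|/injectivePn[i [j nij /(congr1 h')]]] := altP (@injectiveP _ _ h).
  have := max_card [in codom h]; rewrite card_codom // card_ord card_ffun !card_ord.
  by rewrite ltnn.
rewrite !hK.
wlog lt_ij : i j nij / (i < j)%N.
  move=> IH eq_ij; move: (nij); rewrite neq_ltn => /orP[lt|lt]; first exact: IH eq_ij.
  by apply: IH (esym eq_ij); rewrite // eq_sym.
move=> eq_ij; exists (j - i.+1)%N.
by rewrite subnSK // expfB // eq_ij divff // expf_neq0.
Qed.

(** Over a finite [F], nonzero [u] and [v] are roots of unity, hence powers of one [z]. Over an
    infinite [F], [iota t * v - u] works for every [t] whose image avoids the roots of some nonzero
    polynomial. *)
Lemma separable_primitive_element (p q : {poly F}) (u v : L) :
    p != 0 -> root (p ^ iota) u -> root (q ^ iota) v -> separable_poly q ->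
  exists z, (exists P, (P ^ iota).[z] = u) /\ (exists Q, (Q ^ iota).[z] = v).
Proof.
move=> nz_p pu qv sep_q; have nz_q := separable_poly_neq0 sep_q.
have [[s sP]|infF] := pselect (exists s : seq F, forall x, x \in s).
  have X1 (w : L) : exists P, (P ^ iota).[w] = w.
    by exists 'X; rewrite map_polyX hornerX.
  have X0 (w : L) : exists P, (P ^ iota).[w] = 0.
    by exists 0; rewrite rmorph0 horner0.
  have [->|nz_u] := eqVneq u 0; first by exists v.
  have [->|nz_v] := eqVneq v 0; first by exists u.
  have [a ua] := algebraic_over_finite_torsion sP nz_p pu nz_u.
  have [b vb] := algebraic_over_finite_torsion sP nz_q qv nz_v.
  have [z [i [j [-> ->]]]] := torsion_common_power ua vb.
  by exists z; split; [exists 'X^i | exists 'X^j]; rewrite map_polyXn hornerXn.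
have [r nz_r rP] := large_field_PET nz_p pu qv sep_q.
(* A list of [size r] distinct elements is longer than any list of distinct roots of [r]. *)
have [s us sz_s] : exists2 s : seq F, uniq s & size s = size r.
  elim: (size r) => [|n [s us <-]]; first by exists [::].
  have [x /negP xs] : exists x, ~ x \in s.
    apply: contrapT => /forallNP h; apply: infF; exists s => x.
    exact: contrapT (h x).
  by exists (x :: s); rewrite //= us andbT.
have /allPn[_ /mapP[t _ ->] /rP[uz vz]] : ~~ all (root r) [seq iota t | t <- s].
  apply/negP => /(max_poly_roots nz_r).
  rewrite map_inj_uniq ?us ?size_map ?sz_s ?ltnn; last exact: fmorph_inj.
  by move/(_ isT).
by exists (iota t * v - u).
Qed.

End PrimitiveElement.

(** * Fields all of whose simple extensions are minimal *)

Section SubfieldPoly.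
Variables (F L : fieldType) (iota : {rmorphism F -> L}) (k : set L).
Hypothesis kP : forall x, k x <-> exists y, x = iota y.
Hypothesis hk : is_subring k.
Local Notation "p ^ f" := (map_poly f p) : ring_scope.

Lemma lift_poly (p : {poly L}) : (forall i, k p`_i) -> exists P, p = P ^ iota.
Proof.
elim/poly_ind: p => [|p c IHp] kp; first by exists 0; rewrite rmorph0.
have [|P ->] := IHp.
  by move=> i; have := kp i.+1; rewrite coefD coefC coefMX addr0.
have /kP[y ->] : k c by have := kp 0; rewrite coefD coefC coefMX add0r.
by exists (P * 'X + y%:P); rewrite rmorphD rmorphM /= map_polyX map_polyC.
Qed.

Lemma adjoin_rangeP z y : adjoin k z y <-> exists P, y = (P ^ iota).[z].
Proof.
split=> [/(adjoinP hk)[p /lift_poly[P ->] ->]|[P ->]]; first by exists P.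
apply/(adjoinP hk); exists (P ^ iota) => // i; apply/kP.
by exists P`_i; rewrite coef_map.
Qed.

End SubfieldPoly.

Lemma subr_expp_pchar (R : comNzRingType) (p : nat) (x y : R) :
  p \in [pchar R] -> (x - y) ^+ p = x ^+ p - y ^+ p.
Proof. by move=> chp; apply: (pFrobenius_autB_comm chp); apply: mulrC. Qed.

Section IntermediateRings.
Variables (L : fieldType) (k : set L).
Hypothesis hk : is_subfield k.
Hypothesis algk : forall u, u != 0 -> adjoin k u u^-1.

(** [algk] expresses algebraicity over [k]: the inverse of [u] is a polynomial in [u], so it stays
    in any ring containing [k] and [u]. *)
Lemma intermediate_subfield (C : set L) :
  is_subring C -> k `<=` C -> is_subfield C.
Proof.
move=> hC kC; split=> // x Cx; have [->|nz_x] := eqVneq x 0.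
  by rewrite invr0; apply: subring0.
by have [hr _] := hk; apply: (adjoin_min hr hC kC Cx); apply: algk.
Qed.

(* [D] contains the p-th power of [u]: every nonzero polynomial of
   degree less than p with root [u] has a gcd with X^p - u^p = (X - u)^p which
   is (X - u)^j with 0 < j < p, whose second coefficient is - j u. *)
Lemma adjoin_proot_minimal (D : set L) (p : nat) (u e : L) :
    p \in [pchar L] -> is_subring D -> k `<=` D -> D (u ^+ p) ->
  adjoin D u e -> D e \/ adjoin D e u.
Proof.
move=> chp hD kD Dup Due; have [De|nDe] := pselect (D e); [by left|right].
have hC := adjoin_subring hD e; set C := adjoin D e in hC *.
have DC : D `<=` C by apply: adjoin_base.
have hCf : is_subfield C by apply: intermediate_subfield => // x /kD/DC.
have [F1 [i1 DP]] := subfield_rangeP (intermediate_subfield hD kD).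
have [F2 [i2 CP]] := subfield_rangeP hCf.
have p_pr := pcharf_prime chp; have p_gt0 := prime_gt0 p_pr.
have [a1 up1] := (DP _).1 Dup; have [a2 up2] := (CP _).1 (DC _ Dup).
have [f fE] := (adjoin_rangeP DP hD _ _).1 Due.
(* Since [u^p] lies in [D], reduction modulo [X^p - u^p] makes [e] the value at [u] of a polynomial
   over [D] of degree below [p]. *)
pose f' := f %% ('X^p - a1%:P).
have szX : size ('X^p - a1%:P) = p.+1 by rewrite size_XnsubC.
have sz_f' : (size f' <= p)%N.
  by rewrite -ltnS -szX ltn_modp -size_poly_gt0 szX.
have f'E : e = (map_poly i1 f').[u].
  rewrite fE {1}(divp_eq f ('X^p - a1%:P)) rmorphD rmorphM hornerD hornerM /=.
  rewrite rmorphB /= map_polyXn map_polyC /= -up1 !hornerE subrr.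
  by rewrite mulr0 add0r.
(* [G] has coefficients in [D[e]] and root [u]; it is nonzero because [e] is outside [D]. *)
pose G := map_poly i1 f' - e%:P.
have G_root : root G u by rewrite /root !hornerE -f'E subrr.
have sz_G : (size G <= p)%N.
  rewrite (leq_trans (size_polyD _ _)) // geq_max size_map_poly sz_f' size_polyN.
  by rewrite (leq_trans (size_polyC_leq1 _)).
have nz_G : G != 0.
  apply/eqP => /(congr1 (fun q : {poly L} => q`_0)).
  rewrite coefB coefC coef_map coef0 /= => /subr0_eq De; apply: nDe.
  by apply/DP; exists f'`_0.
have [g gE] : exists g, G = map_poly i2 g.
  apply: (lift_poly CP) => i; rewrite coefB coefC coef_map; apply: subringB => //.
    by apply: DC; apply/DP; exists f'`_i.
  by case: eqP => _; [apply: adjoin_gen | apply: subring0].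
pose h := gcdp g ('X^p - a2%:P).
have hE : map_poly i2 h = gcdp G (('X - u%:P) ^+ p).
  rewrite gcdp_map -gE rmorphB /= map_polyXn map_polyC /= -up2.
  by rewrite subr_expp_pchar ?pchar_poly // polyC_exp.
have := dvdp_gcdr G (('X - u%:P) ^+ p); rewrite -hE.
case/dvdp_exp_XsubCP => j _ hj.
have lt_jp : (j < p)%N.
  rewrite -[j.+1](size_exp_XsubC j u) -(eqp_size hj) hE.
  by rewrite (leq_trans _ sz_G) // dvdp_leq // dvdp_gcdl.
have j_gt0 : (0 < j)%N.
  rewrite lt0n; apply/eqP => j0; move: hj; rewrite j0 expr0 => h1.
  have : 'X - u%:P %| map_poly i2 h.
    rewrite hE dvdp_gcd dvdp_XsubCl G_root /=.
    by rewrite -(prednK p_gt0) exprS dvdp_mulr.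
  by rewrite (eqp_dvdr _ h1) dvdp1 size_XsubC.
have /eqpfP hjE := hj; move: hjE.
have -> : lead_coef (('X - u%:P) ^+ j) = 1 by apply/eqP/monic_exp/monicXsubC.
rewrite divr1 => hjE.
have nz_l : lead_coef (map_poly i2 h) != 0.
  by rewrite lead_coef_eq0 hE gcdp_eq0 (negPf nz_G).
have coefj : (('X - u%:P) ^+ j)`_j.-1 = - (u *+ j).
  have := @coefPn_prod_XsubC _ (nseq j u); rewrite size_nseq -lt0n => /(_ j_gt0).
  by rewrite !big_nseq iter_mulr_1 iter_addr_0.
have Cl i : C (map_poly i2 h)`_i by apply/CP; exists h`_i; rewrite coef_map.
have [_ CV] := hCf.
have Cuj : C (u *+ j).
  rewrite -[u *+ j]opprK -coefj; apply: subringN => //.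
  have -> : (('X - u%:P) ^+ j)`_j.-1 =
      (lead_coef (map_poly i2 h))^-1 * (map_poly i2 h)`_j.-1.
    by rewrite [in X in _ * X]hjE coefZ mulrA mulVf // mul1r.
  by apply: subringM => //; apply: CV; rewrite lead_coefE; apply: Cl.
have nz_j : j%:R != 0 :> L.
  rewrite -(dvdn_pcharf chp); apply/negP => /dvdn_leq.
  by rewrite j_gt0 leqNgt lt_jp => /(_ isT).
rewrite -[u](mulfK nz_j) mulr_natr; apply: subringM => //; apply: CV.
exact: subring_nat.
Qed.

Hypothesis simple_minimal : forall u e, adjoin k u e -> k e \/ adjoin k e u.

(** As [v] is outside [k], minimality of [k(z)] over [k] gives [k(v) = k(z)]. *)
Lemma common_generator (u v z : L) :
  ~ k v -> adjoin k z u -> adjoin k z v -> adjoin k v u.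
Proof.
have [hr _] := hk; move=> nkv zu zv.
have [//|vz] := simple_minimal zv.
exact: (adjoin_sub hr vz).
Qed.

(* If [k] is strictly below [D], some [d] in [D] generates a minimal extension
   of [k].  An element [u] outside [D] is not separable over [k], otherwise
   k(d, u) would have a primitive element and k(d) = k(u).  By minimality of
   k(u) over k, an inseparable [u] has its p-th power in [k]. *)
Lemma simple_minimal_lift (D : set L) (u e : L) :
  is_subring D -> k `<=` D -> adjoin D u e -> D e \/ adjoin D e u.
Proof.
have [hr _] := hk; move=> hD kD Due.
have [Dk|] := pselect (D `<=` k).
  have eqDk : D = k by apply/seteqP.
  by rewrite eqDk in Due *; apply: simple_minimal.
move=> /existsNP[d /not_implyP[Dd nkd]].
have [Du|nDu] := pselect (D u); first by left; apply: (adjoin_min hD hD _ Du).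
have [F [iota kP]] := subfield_rangeP hk.
have adP z P : adjoin k z (map_poly iota P).[z] by apply/(adjoin_rangeP kP hr); exists P.
have alg (v : L) : exists2 p, p != 0 & root (map_poly iota p) v.
  have [->|nz_v] := eqVneq v 0.
    by exists 'X; rewrite ?polyX_eq0 // map_polyX rootX.
  (* If the inverse of [v] is [Q(v)], then [X Q - 1] vanishes at [v], and its constant term is
     [-1]. *)
  have /(adjoin_rangeP kP hr)[Q Qv] := algk nz_v; exists ('X * Q - 1).
    apply/eqP => /(congr1 (fun q : {poly F} => q`_0)).
    rewrite coefB coefXM coef1 coef0 sub0r => /eqP.
    by rewrite oppr_eq0 oner_eq0.
  by rewrite /root rmorphB rmorphM /= map_polyX rmorph1 !hornerE -Qv divff // subrr.
have noprim z : adjoin k z u -> adjoin k z d -> False.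
  move=> zu zd; apply: nDu.
  by apply: (adjoin_min hr hD kD Dd); apply: common_generator zd.
have [p nz_p pd] := alg d.
have [ch0|] := pselect ([pchar F] =i pred0).
  have [q nz_q qu] := alg u.
  have [n [[P Pd] [Q Qu]]] := pchar0_PET nz_p pd nz_q qu ch0.
  case: (noprim (u *+ n - d)).
    by have := adP (u *+ n - d) Q; rewrite Qu.
  by have := adP (u *+ n - d) P; rewrite Pd.
move=> /existsNP[c nchc].
have chc : c \in [pchar F] by apply: contrapT => /negP/negPf.
have chL : c \in [pchar L] by rewrite (fmorph_pchar iota).
have nsep q : root (map_poly iota q) u -> ~ separable_poly q.
  move=> qu sep_q.
  have [z [[P Pd] [Q Qu]]] := separable_primitive_element nz_p pd qu sep_q.
  apply: (noprim z); first by have := adP z Q; rewrite Qu.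
  by have := adP z P; rewrite Pd.
have kuc : k (u ^+ c).
  have kuuc : adjoin k u (u ^+ c).
    by apply: subringX; [apply: adjoin_subring | apply: adjoin_gen].
  have [//|/(adjoin_rangeP kP hr)[P uP]] := simple_minimal kuuc.
  (* If [u = P(u^c)], then [u] is a root of [X - P(X^c)], whose derivative is 1 in characteristic
     [c]. *)
  case: (nsep ('X - (P \Po 'X^c))).
    rewrite /root rmorphB /= map_polyX map_comp_poly map_polyXn !hornerE.
    by rewrite horner_comp hornerXn -uP subrr.
  rewrite separable_poly.unlock derivB derivX deriv_comp derivXn.
  by rewrite -scaler_nat pcharf0 // scale0r mulr0 subr0 coprimep1.
by apply: (adjoin_proot_minimal chL) => //; apply: kD.
Qed.

End IntermediateRings.

(** * Valuation rings and their residue fields *)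

(** For a valuation ring this is the maximal ideal. The guard [x != 0] keeps 0 in the set, since
    [0^-1 = 0] lies in [V]. *)
Definition nonunits (K : fieldType) (V : set K) : set K :=
  [set x | V x /\ (x != 0 -> ~ V x^-1)].

Section ValuationRing.
Variables (K : fieldType) (V : set K).
Hypotheses (hV : is_subring V) (valV : forall x, x != 0 -> V x \/ V x^-1).
Local Notation N := (nonunits V).

Lemma nonunits_sub : N `<=` V. Proof. by move=> x []. Qed.

Lemma nonunits0 : N 0.
Proof. by split; [apply: subring0 | rewrite eqxx]. Qed.

Lemma nonunits1 : ~ N 1.
Proof. by case=> V1; rewrite invr1 oner_neq0 => /(_ isT). Qed.

Lemma nonunitsPn x : V x -> ~ N x -> x != 0 /\ V x^-1.
Proof.
move=> Vx nNx; have [x0|nz_x] := eqVneq x 0.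
  by case: nNx; rewrite x0; apply: nonunits0.
by split=> //; apply: contrapT => nVx; apply: nNx.
Qed.

Lemma nonunitsM a x : V a -> N x -> N (a * x).
Proof.
move=> Va [Vx Nx]; split; first exact: subringM.
rewrite mulf_eq0 negb_or => /andP[nz_a nz_x] Vax; apply: (Nx nz_x).
by rewrite -[x^-1](mulVKf nz_a) -invfM; apply: subringM.
Qed.

(** For nonzero summands, [x / y] or [y / x] lies in [V], so the sum is a multiple in [V] of one of
    them. *)
Lemma nonunitsD x y : N x -> N y -> N (x + y).
Proof.
move=> Nx Ny; have [Vx _] := Nx; have [Vy _] := Ny.
have [->|nz_x] := eqVneq x 0; first by rewrite add0r.
have [->|nz_y] := eqVneq y 0; first by rewrite addr0.
have nz_xy : x / y != 0 by rewrite mulf_neq0 ?invr_neq0.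
have [Vxy|] := valV nz_xy.
  have -> : x + y = (x / y + 1) * y by rewrite mulrDl divfK // mul1r.
  by apply: nonunitsM => //; apply: subringD => //; apply: subring1.
rewrite invf_div => Vyx.
have -> : x + y = (1 + y / x) * x by rewrite mulrDl divfK // mul1r.
by apply: nonunitsM => //; apply: subringD => //; apply: subring1.
Qed.

Lemma nonunitsN x : N x -> N (- x).
Proof.
by move=> Nx; rewrite -mulN1r; apply: nonunitsM => //; apply: subringN => //;
  apply: subring1.
Qed.

Lemma nonunits_prime x y : V x -> V y -> N (x * y) -> N x \/ N y.
Proof.
move=> Vx Vy Nxy; apply: contrapT => /not_orP[/(nonunitsPn Vx)[nz_x Vx'] ].
move=> /(nonunitsPn Vy)[nz_y Vy']; apply: nonunits1.
have -> : 1 = x^-1 * y^-1 * (x * y) by rewrite mulrACA !mulVf // mulr1.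
by apply: nonunitsM => //; apply: subringM.
Qed.

Lemma nonunits_inv x : ~ V x -> N x^-1.
Proof.
move=> nVx; have [x0|nz_x] := eqVneq x 0; first by case: nVx; rewrite x0; apply: subring0.
by have [//|Vx'] := valV nz_x; split; rewrite ?invrK.
Qed.

End ValuationRing.

Section ResidueField.
Variables (K : fieldType) (V : set K).
Hypotheses (hV : is_subring V) (valV : forall x, x != 0 -> V x \/ V x^-1).
Local Notation N := (nonunits V).

Definition subring_pred of is_subring V : {pred K} := fun x => `[< V x >].

Lemma subring_predP x : reflect (V x) (x \in subring_pred hV).
Proof. exact: asboolP. Qed.

Fact subring_pred_closed : subring_closed (subring_pred hV).
Proof.
split=> [|x y|x y].
- by apply/subring_predP; apply: subring1.
- by move=> /subring_predP Vx /subring_predP Vy; apply/subring_predP; apply: subringB.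
- by move=> /subring_predP Vx /subring_predP Vy; apply/subring_predP; apply: subringM.
Qed.

HB.instance Definition _ :=
  GRing.isSubringClosed.Build K (subring_pred hV) subring_pred_closed.

Definition subring_type := {x | subring_pred hV x}.

HB.instance Definition _ := [isSub of subring_type for @sval K _].
HB.instance Definition _ := [Choice of subring_type by <:].
HB.instance Definition _ := [SubChoice_isSubComNzRing of subring_type by <:].

Definition nonunits_pred (_ : forall x, x != 0 -> V x \/ V x^-1) : {pred subring_type} :=
  fun x => `[< N (val x) >].

Lemma nonunits_predP x : reflect (N (val x)) (x \in nonunits_pred valV).
Proof. exact: asboolP. Qed.

Lemma subring_typeP (x : subring_type) : V (val x).
Proof. exact/asboolP/(svalP x). Qed.

Fact nonunits_pred_idealr : idealr_closed (nonunits_pred valV).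
Proof.
split=> [||a x y].
- by apply/nonunits_predP; rewrite rmorph0; apply: nonunits0.
- by apply/negP => /nonunits_predP; rewrite rmorph1; apply: nonunits1.
- move=> /nonunits_predP Nx /nonunits_predP Ny; apply/nonunits_predP.
  rewrite rmorphD rmorphM; apply: nonunitsD => //.
  by apply: nonunitsM => //; apply: subring_typeP.
Qed.

HB.instance Definition _ :=
  isIdealr.Build subring_type (nonunits_pred valV) nonunits_pred_idealr.

Definition residue_field := {ideal_quot (nonunits_pred valV)}.

HB.instance Definition _ := GRing.ComNzRing.on residue_field.

(** [insubd] falls back to 0 when the inverse of the representative is not in [V], which happens
    only for the class 0. *)
Definition residue_inv (x : residue_field) : residue_field :=
  (\pi_residue_field (insubd 0 (val (repr x))^-1))%qT.

Lemma residue_pi0P x : (\pi_residue_field x)%qT = 0 <-> N (val x).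
Proof.
have -> : (0 : residue_field) = (\pi_residue_field 0)%qT by rewrite piE.
split=> [/eqP|Nx]; last apply/eqP.
  by rewrite -Quotient.idealrBE subr0 => /nonunits_predP.
by rewrite -Quotient.idealrBE subr0; apply/nonunits_predP.
Qed.

Lemma residue_piD : {morph \pi_residue_field%qT : x y / x + y}.
Proof. by move=> x y; rewrite piE. Qed.

Lemma residue_piM : {morph \pi_residue_field%qT : x y / x * y}.
Proof. by move=> x y; rewrite piE. Qed.

Lemma residue_pi1 : \pi_residue_field%qT 1 = 1.
Proof. by rewrite piE. Qed.

Fact residue_mulVf x : x != 0 -> residue_inv x * x = 1.
Proof.
move=> nz_x; have nNx : ~ N (val (repr x)).
  by move=> /residue_pi0P; rewrite reprK; apply/eqP.
have [nz_rx Vrx] := nonunitsPn hV (subring_typeP _) nNx.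
rewrite /residue_inv -[in X in _ * X](reprK x) -residue_piM -residue_pi1.
congr (\pi_residue_field%qT _); apply: val_inj; rewrite rmorphM /= insubdK ?mulVf //.
exact/subring_predP.
Qed.

Fact residue_inv0 : residue_inv 0 = 0.
Proof.
apply/residue_pi0P.
have /residue_pi0P [_ h] : (\pi_residue_field%qT (repr (0 : residue_field))) = 0.
  by rewrite reprK.
have [r0|nz_r] := eqVneq (val (repr (0 : residue_field))) 0.
  rewrite r0 invr0 insubdK; first exact: nonunits0.
  by apply/subring_predP; apply: subring0.
rewrite /insubd insubF; first by rewrite rmorph0; apply: nonunits0.
by apply/negP => /subring_predP; apply: h.
Qed.

HB.instance Definition _ :=
  GRing.ComNzRing_isField.Build residue_field residue_mulVf residue_inv0.

End ResidueField.

(** The residue map is a function on all of [K], with laws on [V] only, so that rings remain sets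
    inside [K]. *)
Lemma residue_fieldP (K : fieldType) (V : set K) :
    is_subring V -> (forall x, x != 0 -> V x \/ V x^-1) ->
  exists (L : fieldType) (pi : K -> L),
    [/\ pi 1 = 1, forall x y, V x -> V y -> pi (x - y) = pi x - pi y,
        forall x y, V x -> V y -> pi (x * y) = pi x * pi y,
        forall x, V x -> (pi x = 0 <-> nonunits V x)
      & forall u, exists2 x, V x & pi x = u].
Proof.
move=> hV valV; pose Q := residue_field hV valV.
pose p (x : subring_type hV) : Q := (\pi_Q%qT x).
pose pi (x : K) : Q := p (insubd 0 x).
have piE x (Vx : x \in subring_pred hV) : pi x = p (Sub x Vx).
  by rewrite /pi; congr p; apply: val_inj; rewrite insubdK.
have inV x : V x -> x \in subring_pred hV by move=> Vx; apply/subring_predP.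
have pB x y : p (x - y) = p x - p y.
  have pN : p (- y) = - p y.
    by apply/eqP; rewrite -addr_eq0 -residue_piD addNr; apply/eqP/residue_pi0P;
      rewrite rmorph0; apply: nonunits0.
  have pD z t : p (z + t) = p z + p t by apply: residue_piD.
  by rewrite pD pN.
exists Q, pi; split.
- rewrite (piE 1 (inV _ (subring1 hV))) -residue_pi1; congr p; exact: val_inj.
- move=> x y Vx Vy; rewrite (piE _ (inV _ (subringB hV Vx Vy))) (piE _ (inV _ Vx)).
  by rewrite (piE _ (inV _ Vy)) -pB; congr p; apply: val_inj.
- move=> x y Vx Vy; rewrite (piE _ (inV _ (subringM hV Vx Vy))) (piE _ (inV _ Vx)).
  by rewrite (piE _ (inV _ Vy)) -residue_piM; congr p; apply: val_inj.
- by move=> x Vx; rewrite (piE _ (inV _ Vx)); apply: residue_pi0P.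
- move=> u; exists (val (repr u)); first exact: subring_typeP.
  by rewrite /pi valKd /p reprK.
Qed.

Section ValuativeLift.
Variables (K : fieldType) (V S T : set K).
Hypotheses (hV : is_subring V) (valV : forall x, x != 0 -> V x \/ V x^-1).
Hypotheses (hS : is_subring S) (hT : is_subring T).
Hypotheses (NS : nonunits V `<=` S) (ST : S `<=` T) (TV : T `<=` V).
Hypothesis invS : forall x, V x^-1 -> adjoin S x x^-1.

(** A ring that contains [nonunits V] and lies in [V] is the full preimage of its image in the
    residue field, so minimality can be tested on images; there [simple_minimal_lift] passes from
    the image of [S] to that of [T]. [invS] makes the residue extension algebraic. *)
Lemma valuative_lift :
    (forall x, x != 0 -> no_ring_strictly_between S (adjoin S x) \/
       no_ring_strictly_between S (adjoin S x^-1)) ->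
  forall x, x != 0 -> no_ring_strictly_between T (adjoin T x) \/
       no_ring_strictly_between T (adjoin T x^-1).
Proof.
move=> minS; have [L [pi [pi1 piB piM pi0P pi_surj]]] := residue_fieldP hV valV.
have SV : S `<=` V by move=> x /ST/TV.
have image_subring A : is_subring A -> A `<=` V -> is_subring (pi @` A).
  move=> hA AV; apply: subringI.
  - by exists 1 => //; apply: subring1.
  - move=> _ _ [x Ax <-] [y Ay <-]; exists (x - y); first exact: subringB.
    by rewrite piB //; apply: AV.
  - move=> _ _ [x Ax <-] [y Ay <-]; exists (x * y); first exact: subringM.
    by rewrite piM //; apply: AV.
have adjV A x : is_subring A -> A `<=` V -> V x -> adjoin A x `<=` V.
  by move=> hA AV; apply: adjoin_min.
have image_adjoin A x : is_subring A -> A `<=` V -> V x ->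
    forall u, adjoin (pi @` A) (pi x) u <-> exists2 y, adjoin A x y & pi y = u.
  move=> hA AV Vx u; have hpA := image_subring _ hA AV; split.
    have hpAx := image_subring _ (adjoin_subring hA x) (adjV _ _ hA AV Vx).
    apply: (adjoin_min hpA hpAx); last by exists x => //; apply: adjoin_gen.
    by move=> _ [y Ay <-]; exists y => //; apply: adjoin_base.
  case=> y Axy <-; have hB := adjoin_subring hpA (pi x).
  (* The preimage in [V] of [pi(A)[pi x]] is a ring containing [A] and [x], hence [A[x]]. *)
  pose C := [set y | V y /\ adjoin (pi @` A) (pi x) (pi y)].
  have hC : is_subring C.
    apply: subringI; rewrite /C /=.
    - by split; [apply: subring1 | rewrite pi1; apply: subring1].
    - move=> a b [Va Ba] [Vb Bb]; split; first exact: subringB.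
      by rewrite piB //; apply: subringB.
    - move=> a b [Va Ba] [Vb Bb]; split; first exact: subringM.
      by rewrite piM //; apply: subringM.
  suff /(_ y Axy) [] : adjoin A x `<=` C by [].
  apply: adjoin_min => //; last by split; last exact: adjoin_gen.
  move=> a Aa; split; first exact: AV.
  by apply: adjoin_base => //; exists a.
have unitP x : V x -> pi x != 0 -> x != 0 /\ V x^-1.
  move=> Vx nz_px; apply: nonunitsPn => // /(pi0P x Vx) px0.
  by rewrite px0 eqxx in nz_px.
have piV x : V x -> pi x != 0 -> pi x^-1 = (pi x)^-1.
  move=> Vx nz_px; have [nz_x Vx'] := unitP x Vx nz_px.
  by apply: (mulfI nz_px); rewrite -piM // !divff.
set k := pi @` S; have hkr : is_subring k by apply: image_subring.
have algk u : u != 0 -> adjoin k u u^-1.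
  have [x Vx <-] := pi_surj u => nz_px; have [nz_x Vx'] := unitP x Vx nz_px.
  by apply/(image_adjoin S x hS SV Vx); exists x^-1; [apply: invS | apply: piV].
have hk : is_subfield k.
  split=> // u ku; have [->|nz_u] := eqVneq u 0.
    by rewrite invr0; apply: subring0.
  by apply: (adjoin_min hkr hkr (fun _ => id) ku); apply: algk.
have mink u e : adjoin k u e -> k e \/ adjoin k e u.
  have [->|nz_u] := eqVneq u 0.
    by move=> k0e; left; apply: (adjoin_min hkr hkr _ _ k0e) => //; apply: subring0.
  have [x Vx xu] := pi_surj u; rewrite -xu in nz_u *.
  have [nz_x Vx'] := unitP x Vx nz_u.
  move=> /(image_adjoin S x hS SV Vx)[y Sxy <-].
  have Vy : V y by apply: (adjV S x hS SV Vx).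
  case: (minS x nz_x) => /(no_ring_betweenP hS) minx.
    have [Sy|Syx] := minx _ Sxy; first by left; exists y.
    by right; apply/(image_adjoin S y hS SV Vy); exists x.
  (* When the minimality known is that of [S[x^-1]], this ring contains [S[x]]; the residue ring
     [k[pi y]] is a field, so containing the inverse of [pi x] suffices. *)
  have Sx'x : adjoin S x^-1 x by have := @invS x^-1; rewrite invrK; apply.
  have [Sy|Syx'] := minx _ (adjoin_sub hS Sx'x Sxy); first by left; exists y.
  right; have : adjoin k (pi y) (pi x)^-1.
    by apply/(image_adjoin S y hS SV Vy); exists x^-1; last exact: piV.
  have [_ kyV] : is_subfield (adjoin k (pi y)).
    apply: (intermediate_subfield hk algk); first exact: adjoin_subring.
    exact: adjoin_base.
  by move=> /kyV; rewrite invrK.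
have kD : k `<=` pi @` T by move=> _ [x Sx <-]; exists x => //; apply: ST.
have pi_sat A e : is_subring A -> nonunits V `<=` A -> A `<=` V -> V e ->
    (pi @` A) (pi e) -> A e.
  move=> hA NA AV Ve [a Aa pae]; rewrite -(subrK a e); apply: subringD => //.
  have Va := AV _ Aa; apply/NA/(pi0P _ (subringB hV Ve Va)).
  by rewrite piB // pae subrr.
have minT x : V x -> x != 0 -> no_ring_strictly_between T (adjoin T x).
  move=> Vx nz_x; apply/(no_ring_betweenP hT) => e Txe.
  have Ve : V e by apply: (adjV T x hT TV Vx).
  have NT : nonunits V `<=` T by move=> y /NS/ST.
  have /(simple_minimal_lift hk algk mink (image_subring _ hT TV) kD) :
    adjoin (pi @` T) (pi x) (pi e) by apply/(image_adjoin T x hT TV Vx); exists e.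
  case=> [/(pi_sat T e hT NT TV Ve)|Tex]; [by left | right].
  have TVe := adjV T e hT TV Ve.
  apply: pi_sat Vx _ => //; first exact: adjoin_subring.
    by move=> y /NT; apply: adjoin_base.
  by have /(image_adjoin T e hT TV Ve)[y Tey <-] := Tex; exists y.
move=> x nz_x; have [Vx|Vx'] := valV nz_x; first by left; apply: minT.
by right; apply: minT => //; rewrite invr_neq0.
Qed.

End ValuativeLift.

(** * Pseudo-valuation domains *)

Lemma exists_maximal_ideal (K : fieldType) (S : set K) : is_subring S ->
  exists M, [/\ is_ideal S M, ~ M 1
    & forall a, S a -> ~ M a -> exists2 s, S s & M (1 - s * a)].
Proof.
move=> hS; pose P X := X = set0 \/ (is_ideal S X /\ ~ X 1).
have [|A [PA maxA]] := @Zorn_bigcup K P.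
  move=> F FP totF.
  have [[X0 [FX0 X00]]|F0] := pselect (exists X, F X /\ X 0); last first.
    left; apply/seteqP; split=> // x [X FX Xx].
    have [X0|[[_ X0 _ _] _]] := FP X FX; first by rewrite X0 in Xx.
    by case: F0; exists X.
  have FI X x : F X -> X x -> is_ideal S X /\ ~ X 1.
    by move=> FX Xx; case: (FP X FX) Xx => [->|].
  right; split; last by case=> X FX X1; case: (FI X 1 FX X1) => _; apply.
  split.
  - by move=> x [X FX Xx]; have [[XS _ _ _] _] := FI X x FX Xx; apply: XS.
  - by exists X0.
  - move=> x y [X FX Xx] [Y FY Yy].
    have [XY|YX] := totF X Y FX FY.
      by exists Y => //; have [[_ _ YD _] _] := FI Y y FY Yy; apply: YD (XY x Xx) Yy.
    by exists X => //; have [[_ _ XD _] _] := FI X x FX Xx; apply: XD Xx (YX y Yy).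
  - move=> a x Sa [X FX Xx]; exists X => //.
    by have [[_ _ _ XM] _] := FI X x FX Xx; apply: XM.
have [A0|[idA nA1]] := PA.
  (* The zero ideal properly contains the empty set, so a maximal element is not empty. *)
  case: (maxA [set 0]); first by rewrite A0; split=> // h; apply: (h 0).
  right; split; last by move/eqP; rewrite oner_eq0.
  split=> [_ ->|//|_ _ -> ->|a _ _ ->]; [exact: subring0 | exact: addr0 | exact: mulr0].
have [AS A0 AD AM] := idA; exists A; split=> // a Sa nAa.
pose J := [set y | exists b s, [/\ A b, S s & y = b + s * a]].
have AJ : A `<` J.
  split=> [b Ab|JA].
    by exists b, 0; rewrite mul0r addr0; split=> //; apply: subring0.
  by apply/nAa/JA; exists 0, 1; rewrite mul1r add0r; split=> //; apply: subring1.
have : ~ ~ J 1.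
  move=> nJ1; apply: (maxA J AJ); right; split=> //; split.
  - move=> _ [b [s [Ab Ss ->]]]; apply: subringD => //; first exact: AS.
    exact: subringM.
  - by apply: AJ.1.
  - move=> _ _ [b [s [Ab Ss ->]]] [c [t [Ac St ->]]]; exists (b + c), (s + t).
    by rewrite mulrDl addrACA; split=> //; [apply: AD | apply: subringD].
  - move=> c _ Sc [b [s [Ab Ss ->]]]; exists (c * b), (c * s).
    by rewrite mulrDr mulrA; split=> //; [apply: AM | apply: subringM].
by move=> /contrapT[b [s [Ab Ss e1]]]; exists s; rewrite // e1 addrK.
Qed.

Lemma maximal_ideal_prime (K : fieldType) (S M : set K) :
    is_subring S -> is_ideal S M -> ~ M 1 ->
    (forall a, S a -> ~ M a -> exists2 s, S s & M (1 - s * a)) ->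
  prime_ideal S M.
Proof.
move=> hS idM nM1 maxM; split=> // x y Sx Sy Mxy.
have [|nMx] := pselect (M x); [by left | right].
have [MS M0 MD MM] := idM; have [s Ss Ms] := maxM x Sx nMx.
have -> : y = y * (1 - s * x) + s * (x * y).
  by rewrite mulrBr mulr1 mulrC -[s * x * y]mulrA subrK.
by apply: MD; apply: MM.
Qed.

(* With [M] maximal and x, 1/x both outside [V], pseudo-valuation gives
   x M <= M, so coefficients in [M] of a relation satisfied by x can be moved
   to its constant term; a relation with a coefficient outside [M] thus makes
   x integral over [V].  The relation used is x = p(x^2). *)
Lemma pseudo_valuation_minimal_adjoin (K : fieldType) (V : set K) (x : K) :
    is_subring V -> (forall y, qf V y) -> pseudo_valuation V ->
    (forall (p : {poly K}) y, p \is monic -> (forall i, V p`_i) -> root p y -> V y) ->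
    no_ring_strictly_between V (adjoin V x) ->
  V x \/ V x^-1.
Proof.
move=> hV qfV pvV icV /(no_ring_betweenP hV) minx.
apply: contrapT => /not_orP[nVx nVx'].
have nz_x : x != 0 by apply/eqP => x0; apply: nVx; rewrite x0; apply: subring0.
have [M [idM nM1 maxM]] := exists_maximal_ideal hV.
have [MV M0 MD MM] := idM.
(* [m] is the product of [x^-1] and [x * m] and lies in the prime [M]; as [x^-1] is outside [V],
   [x * m] is in [M]. *)
have Mx m : M m -> M (x * m).
  move=> Mm; have := @pvV M (maximal_ideal_prime hV idM nM1 maxM) x^-1 (x * m).
  by rewrite mulKf // => /(_ (qfV _) (qfV _) Mm) [/MV|].
have Mxn m n : M m -> M (x ^+ n * m).
  by move=> Mm; elim: n => [|n IHn]; rewrite ?expr0 ?mul1r // exprS -mulrA; apply: Mx.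
have coefM n (q : {poly K}) : (size q <= n)%N -> (forall i, V q`_i) -> V q.[x] ->
    forall i, M q`_i.+1.
  elim: n q => [|n IHn] q sz_q Vq Vqx i.
    by rewrite nth_default // (leq_trans sz_q).
  case: n => [|n] in IHn sz_q *; first by rewrite nth_default // (leq_trans sz_q).
  have qE : q = take_poly n.+1 q + q`_n.+1 *: 'X^(n.+1).
    apply/polyP => j; rewrite coefD coef_take_poly coefZ coefXn.
    case: ltngtP => [||->]; rewrite ?mulr0 ?addr0 ?mulr1 ?add0r // => lt_nj.
    by rewrite nth_default // (leq_trans sz_q).
  have Vtk j : V (take_poly n.+1 q)`_j.
    by rewrite coef_take_poly; case: ifP => // _; apply: subring0.
  have Mn : M q`_n.+1.
    apply: contrapT => /(maxM _ (Vq _))[s Ss Ms]; apply: nVx.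
    have Vr : V ((s *: take_poly n.+1 q).[x] + x ^+ n.+1).
      have -> : (s *: take_poly n.+1 q).[x] + x ^+ n.+1 =
          s * q.[x] + x ^+ n.+1 * (1 - s * q`_n.+1).
        rewrite {2}qE !hornerE mulrBr mulr1 mulrDr mulrA [x ^+ _ * _]mulrC.
        by rewrite addrA addrAC addrK.
      by apply: subringD => //; [apply: subringM | apply/MV/Mxn].
    set c := (X in V X) in Vr.
    apply: (icV ('X^(n.+1) + (s *: take_poly n.+1 q - c%:P))).
    - rewrite monicE lead_coefDl ?lead_coefXn // size_polyXn ltnS.
      rewrite (leq_trans (size_polyD _ _)) // size_polyN geq_max.
      rewrite (leq_trans (size_scale_leq _ _)) ?size_take_poly //.
      by rewrite (leq_trans (size_polyC_leq1 _)).
    - move=> j; rewrite coefD coefB coefXn coefZ coefC; apply: subringD => //.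
        exact: subring_nat.
      apply: subringB => //; first exact: subringM.
      by case: eqP => _ //; apply: subring0.
    - by rewrite /root !hornerE /c !hornerE subr_eq0; apply/eqP/addrC.
  have [lt_in|] := ltnP i.+1 n.+1; last first.
    rewrite leq_eqVlt => /orP[/eqP<- //|lt_ni].
    by rewrite nth_default // (leq_trans sz_q).
  have := IHn (take_poly n.+1 q) (size_take_poly _ _) Vtk _ i.
  rewrite coef_take_poly lt_in; apply.
  have -> : (take_poly n.+1 q).[x] = q.[x] - x ^+ n.+1 * q`_n.+1.
    by rewrite {2}qE !hornerE [x ^+ _ * _]mulrC addrK.
  by apply: subringB => //; apply/MV/Mxn.
(* Minimality is tested on [x ^+ 2]: either it lies in [V] and [x] is integral, or [x = p(x^2)]. *)
have Vxx : adjoin V x (x ^+ 2).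
  by apply: subringX; [apply: adjoin_subring | apply: adjoin_gen].
have [Vx2|] := minx _ Vxx.
  apply: nVx; apply: (icV ('X^2 - (x ^+ 2)%:P)); first exact: monicXnsubC.
    move=> i; rewrite coefB coefXn coefC; apply: subringB => //.
      exact: subring_nat.
    by case: eqP => _ //; apply: subring0.
  by rewrite /root !hornerE subrr.
move=> /(adjoinP hV)[p Vp px].
(* The coefficient of [X] in [p(X^2) - X] is [-1], which would lie in [M]. *)
have := coefM _ (p \Po 'X^2 - 'X) (leqnn _) _ _ 0.
rewrite coefB coefX coef_comp_poly_Xn // => hM; apply: nM1.
rewrite -[1]mulr1 -mulrNN; apply: MM; first by apply: subringN => //; apply: subring1.
have := hM; rewrite /= sub0r; apply.
- move=> i; rewrite coefB coefX coef_comp_poly_Xn //; apply: subringB => //.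
    by case: ifP => // _; apply: subring0.
  exact: subring_nat.
- by rewrite hornerD hornerN horner_comp hornerXn hornerX -px subrr; apply: subring0.
Qed.

Section NonunitsPseudoValuation.
Variables (K : fieldType) (V T : set K).
Hypotheses (hV : is_subring V) (valV : forall x, x != 0 -> V x \/ V x^-1).
Hypotheses (hT : is_subring T) (TV : T `<=` V) (qfT : forall x, qf T x).
Local Notation N := (nonunits V).

(** If [n] in [N] is outside [T], the prime [P] of elements common to [T] and [N] is closed under
    division by [n]. Peeling off constant terms, a polynomial over [T] with value in [P] at [n] has
    all coefficients in [N]; a monic one vanishing at [n] contradicts this. *)
Lemma nonunits_sub_pseudo_valuation :
    pseudo_valuation T ->
    (forall x, V x -> exists2 p : {poly K}, p \is monic
       & (forall i, T p`_i) /\ root p x) ->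
  N `<=` T.
Proof.
move=> pvT intT n Nn; apply: contrapT => nTn.
have nz_n : n != 0 by apply/eqP => n0; apply: nTn; rewrite n0; apply: subring0.
pose P := [set x | T x /\ N x].
have idP : prime_ideal T P.
  split; [split | by case=> _; apply: nonunits1 |].
  - by move=> x [].
  - by split; [apply: subring0 | apply: nonunits0].
  - by move=> x y [Tx Nx] [Ty Ny]; split; [apply: subringD | apply: nonunitsD].
  - move=> a x Ta [Tx Nx]; split; first exact: subringM.
    by apply: nonunitsM => //; apply: TV.
  - move=> x y Tx Ty [_ Nxy].
    by have [Nx|Ny] := nonunits_prime hV (TV Tx) (TV Ty) Nxy; [left | right].
have Pdiv c : P c -> P (c / n).
  move=> Pc; have := @pvT P idP n (c / n) (qfT _) (qfT _).
  by rewrite mulrC divfK // => /(_ Pc) [[]|].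
have coefN (p : {poly K}) : (forall i, T p`_i) -> P p.[n] -> forall i, N p`_i.
  elim/poly_ind: p => [|p c IHp] Tp Pp i; first by rewrite coef0; apply: nonunits0.
  have coefp j : (p * 'X + c%:P)`_j.+1 = p`_j by rewrite coefD coefC coefMX addr0.
  have coef0 : (p * 'X + c%:P)`_0 = c by rewrite coefD coefC coefMX add0r.
  have Tp' j : T p`_j by rewrite -coefp.
  have Tc : T c by rewrite -coef0.
  rewrite hornerMXaddC in Pp.
  have Vpn : V p.[n].
    by apply: subring_horner => // [j|]; [apply: TV | apply: nonunits_sub].
  have Nc : N c.
    rewrite -[c](addKr (p.[n] * n)) addrC; apply: nonunitsD => //; first by case: Pp.
    by apply: nonunitsN => //; apply: nonunitsM.
  have Ppn : P p.[n].
    rewrite -[p.[n]](mulfK nz_n); apply: Pdiv.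
    have [Tpc Npc] := Pp; split; first by rewrite -(addrK c (_ * n)); apply: subringB.
    exact: nonunitsM.
  by case: i => [|i]; rewrite ?coef0 ?coefp //; apply: IHp.
have [p /monicP lp [Tp pn]] := intT n (nonunits_sub Nn).
have P0 : P p.[n] by rewrite (rootP pn); split; [apply: subring0 | apply: nonunits0].
by apply: (nonunits1 (V := V)); rewrite -lp lead_coefE; apply: coefN.
Qed.

(** A factor outside [V] has its inverse in [N], hence in [T], and cancels. Two units of [V] cannot
    have their product in [P], since [invT] would put 1 in [P]. *)
Lemma pseudo_valuation_nonunits_sub :
    N `<=` T -> (forall x, T x -> V x^-1 -> T x^-1) -> pseudo_valuation T.
Proof.
move=> NT invT P [[PT P0 PD PM] nP1 Pprime] x y _ _ Pxy.
have nVP a b : P (a * b) -> ~ V a -> P b.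
  move=> Pab nVa; have Na := nonunits_inv hV valV nVa.
  have nz_a : a != 0 by apply/eqP => a0; apply: nVa; rewrite a0; apply: subring0.
  by rewrite -(mulKf nz_a b); apply: PM => //; apply: NT.
have VP a b : P (a * b) -> N a -> V b -> P a \/ P b.
  move=> Pab Na Vb; have [Nb|nNb] := pselect (N b).
    by apply: Pprime => //; apply: NT.
  left; have [nz_b Vb'] := nonunitsPn hV Vb nNb.
  have Ta : T a by apply: NT.
  suff : P (a * a) by move=> /(Pprime a a Ta Ta)[].
  (* [b] is a unit of [V], so [b^-1 * a] is in [N], hence in [T]. *)
  have -> : a * a = b^-1 * a * (a * b) by rewrite [a * b]mulrC mulrACA mulVf // mul1r.
  by apply: PM => //; apply: NT; apply: nonunitsM.
have [Vx|nVx] := pselect (V x); last by right; apply: nVP nVx.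
have [Vy|nVy] := pselect (V y); last by left; apply: nVP nVy; rewrite mulrC.
have [Nx|nNx] := pselect (N x); first exact: VP.
have [Ny|nNy] := pselect (N y); first by apply/or_comm/VP; rewrite // mulrC.
have [nz_x Vx'] := nonunitsPn hV Vx nNx.
have [nz_y Vy'] := nonunitsPn hV Vy nNy.
case: nP1; rewrite -(mulVf (mulf_neq0 nz_x nz_y)); apply: PM => //.
by apply: invT; [apply: PT | rewrite invfM; apply: subringM].
Qed.

(** This is [T + N], closed under products because [N] is an ideal of [V]. *)
Lemma add_nonunits_subring : is_subring [set x | exists2 a, T a & N (x - a)].
Proof.
apply: subringI => /=.
- by exists 1; [apply: subring1 | rewrite subrr; apply: nonunits0].
- move=> x y [a Ta Nx] [b Tb Ny]; exists (a - b); first exact: subringB.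
  by rewrite opprD addrACA -opprD; apply: nonunitsD => //; apply: nonunitsN.
- move=> x y [a Ta Nx] [b Tb Ny]; exists (a * b); first exact: subringM.
  have -> : x * y - a * b = y * (x - a) + a * (y - b).
    by rewrite !mulrBr [y * x]mulrC [y * a]mulrC addrA subrK.
  have Vy : V y.
    by rewrite -(subrK b y); apply: subringD; [|apply: nonunits_sub|apply: TV].
  by apply: nonunitsD => //; apply: nonunitsM => //; apply: TV.
Qed.

End NonunitsPseudoValuation.

(** * The ring inside its fraction field, and its integral closure *)

Section BaseRing.
Variable R : idomainType.
Local Notation K := {fraction R}.
Local Notation B := (@base_ring R).
Local Notation V := (@integral_closure R).

Lemma integral_closure_subring : is_subring V.
Proof.
apply: subringI => [|x y|x y]; first exact: integral1.
- exact: integral_sub.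
- exact: integral_mul.
Qed.

Lemma integral_closure_closed (p : {poly K}) y :
  p \is monic -> (forall i, V p`_i) -> root p y -> V y.
Proof.
by move=> mon_p Vp py; apply: integral_root_monic mon_p py _; apply/integral_poly.
Qed.

Lemma qf_base_ring_sub (S : set K) x : B `<=` S -> qf S x.
Proof.
move=> BS; pose n := tofrac \n_(repr x); pose d := tofrac \d_(repr x).
have nz_d : d != 0 by rewrite tofrac_eq0 denom_ratioP.
exists n, d; split=> //; first by apply: BS; exists \n_(repr x).
  by apply: BS; exists \d_(repr x).
apply: (canRL (mulfK nz_d)); rewrite /n /d -[in LHS](reprK x); unlock FracField.tofrac.
rewrite -[LHS]FracField.pi_mul; apply/eqmodP.
rewrite /= /FracField.equivf /FracField.mulf.
rewrite !numden_Ratio ?mulf_neq0 ?oner_eq0 ?denom_ratioP //.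
by rewrite !mulr1 reprK mulrC.
Qed.

(** Multiplying an integral equation of degree [n + 1] by [y^-n] writes [y] as a polynomial in
    [y^-1] over [B]. *)
Lemma integral_inv_mem (C : set K) y :
  is_subring C -> B `<=` C -> V y -> C y^-1 -> C y.
Proof.
move=> hC BC [p mon_p py] Cy'.
have [->|nz_y] := eqVneq y 0; first exact: subring0.
have mon_q : map_poly (@tofrac R) p \is monic by apply: monic_map.
set q := map_poly _ p in mon_q py.
have sz_q : (0 < size q)%N by rewrite size_poly_gt0 monic_neq0.
move: py; rewrite /root horner_coef -(prednK sz_q) big_ord_recr /=.
rewrite -lead_coefE (monicP mon_q) mul1r.
case: (size q).-1 => [|n]; first by rewrite big_ord0 add0r expr0 oner_eq0.
rewrite addrC addr_eq0 => /eqP yn.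
have -> : y = - \sum_(i < n.+1) q`_i * y^-1 ^+ (n - i).
  have yE : y = y ^+ n.+1 * y^-1 ^+ n by rewrite exprVn exprS mulfK // expf_neq0.
  rewrite [LHS]yE yn mulNr mulr_suml; congr (- _); apply: eq_bigr => i _.
  have le_in : (i <= n)%N by rewrite -ltnS.
  rewrite -mulrA; congr (_ * _).
  rewrite -[in y^-1 ^+ n](subnK le_in) exprD mulrCA -exprMn mulfV //.
  by rewrite expr1n mulr1.
apply: subringN => //; apply: subring_sum => // i.
apply: subringM => //; last exact: subringX.
by rewrite coef_map; apply: BC; exists p`_i.
Qed.

End BaseRing.

Theorem theorem2p13 (R : idomainType)
    (hR : maximal_non (@pseudo_valuation {fraction R})
            (@base_ring R) (@integral_closure R)) :
  maximal_non (@valuative {fraction R}) (@base_ring R) (@integral_closure R)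
  <->
  [/\ ~ valuative (@base_ring R),
      valuation_domain (@integral_closure R)
    & exists S : set {fraction R},
        unique_minimal_overring (@base_ring R) (@integral_closure R) S
        /\ valuative S].
Proof.
have [hB BV npvB pvB] := hR; set B := @base_ring R in hB BV npvB pvB *.
set V := @integral_closure R in BV pvB *; have [BsV nVB] := BV.
have hV : is_subring V := integral_closure_subring R.
have qfB S x : B `<=` S -> qf S x by apply: qf_base_ring_sub.
have intT (T : set {fraction R}) x : B `<=` T -> V x ->
    exists2 p : {poly {fraction R}}, p \is monic & (forall i, T p`_i) /\ root p x.
  move=> BT [p mon_p px]; exists (map_poly (@tofrac R) p); first exact: monic_map.
  by split=> // i; rewrite coef_map; apply: BT; exists p`_i.
have NT (T : set {fraction R}) : (forall x, x != 0 -> V x \/ V x^-1) ->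
    is_subring T -> B `<` T -> T `<=` V -> nonunits V `<=` T.
  move=> valV hT BT TV; have [BsT _] := BT.
  apply: (nonunits_sub_pseudo_valuation hV valV hT TV) => [x||x].
  - exact: qfB.
  - exact: pvB.
  - exact: intT.
split=> [[_ _ nvB vB]|[nvB vdV [S [[hS BS SV minS] vS]]]].
  (* [V] is itself one of the rings properly above [B], so both maximality hypotheses apply to
     it. *)
  have valV x : x != 0 -> V x \/ V x^-1.
    move=> nz_x; have vV : valuative V by apply: vB.
    have valV1 := pseudo_valuation_minimal_adjoin hV (fun y => qfB V y BsV)
      (pvB V hV BV (fun _ => id)) (@integral_closure_closed R).
    have [/valV1 //|/valV1] := vV x (qfB V x BsV) nz_x.
    by rewrite invrK => /or_comm.
  split=> //; first by move=> x _; apply: valV.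
  pose S := [set x | exists2 a, B a & nonunits V (x - a)].
  have hS : is_subring S by apply: add_nonunits_subring.
  have BsS : B `<=` S by move=> a Ba; exists a; rewrite // subrr; apply: nonunits0.
  have NS : nonunits V `<=` S.
    by move=> x Nx; exists 0; [apply: subring0 | rewrite subr0].
  have SV : S `<=` V.
    move=> x [a Ba Nx]; rewrite -(subrK a x); apply: subringD => //.
      exact: nonunits_sub.
    exact: BsV.
  have BS : B `<` S.
    (* If [S = B], then [B] contains the nonunits of [V], and integrality makes units of [V] lying
       in [B] units of [B]; so [B] would be pseudo-valuation. *)
    split=> // SB; apply: npvB.
    apply: (pseudo_valuation_nonunits_sub hV valV).
      by move=> x /NS/SB.
    move=> x Bx Vx'; apply: (integral_inv_mem hB) => //.
    by rewrite invrK.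
  exists S; split; last exact: vB.
  split=> // A hA BA AV x [a Ba Nx]; rewrite -(subrK a x); apply: subringD => //.
    exact: (NT A).
  by apply: BA.1.
have valV x : x != 0 -> V x \/ V x^-1 by apply: vdV; apply: qfB.
split=> // T hT BT TV; have ST := minS T hT BT TV.
have BsS := BS.1.
(* [x^-1] is integral over [B] and its inverse [x] lies in [S[x]]. *)
have invS x : V x^-1 -> adjoin S x x^-1.
  move=> Vx'; apply: integral_inv_mem => //.
  - exact: adjoin_subring.
  - by move=> a /BsS; apply: adjoin_base.
  - by rewrite invrK; apply: adjoin_gen.
move=> x _; apply: (valuative_lift hV valV hS hT (NT S valV hS BS SV) ST TV invS).
by move=> y; apply: vS; apply: qfB.
Qed.
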